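(* Let $\alpha\ge3$, $t_0>0$, $x_0\in\mathcal H$, and let $x:[t_0,+\infty)\to\mathcal H$ be a solution of the Cauchy problem $$\tfrac{\alpha}{t}\dot x(t)+\operatorname{proj}_{C(x(t))+\ddot x(t)}(0)=0\ (t>t_0),\qquad x(t_0)=x_0,\ \dot x(t_0)=0 .$$ Assume the Assumption on the weak Pareto set in the context holds, and let $R$ be the constant defined there with respect to $x_0$. Then for all $t\in[t_0,+\infty)$ $$t^2u_0(x(t))\le t_0^2u_0(x_0)+2(\alpha-1)R+(3-\alpha)\int_{t_0}^t s\|\dot x(s)\|^2\,ds,$$ and hence $u_0(x(t))\le \dfrac{t_0^2u_0(x_0)+2(\alpha-1)R}{t^2}$ for all $t\in[t_0,+\infty)$.
   Context: $\mathcal H$ is a real Hilbert space. $f_1,\dots,f_m:\mathcal H\to\mathbb R$ are convex and continuously differentiable, and $F=(f_1,\dots,f_m)$. $C(x)=\operatorname{co}\{\nabla f_i(x):i=1,\dots,m\}$. For a closed convex $K\subset\mathcal H$, $\operatorname{proj}_K(y)=\arg\min_{w\in K}\|w-y\|^2$. A solution of the Cauchy problem is a function $x:[t_0,+\infty)\to\mathcal H$ such that: $x\in C^1([t_0,+\infty))$; $\dot x$ is absolutely continuous on $[t_0,T]$ for every $T\ge t_0$; there is a Bochner measurable $\ddot x$ with $\dot x(t)=\dot x(t_0)+\int_{t_0}^t\ddot x(s)\,ds$ for all $t$, and $\frac{d}{dt}\dot x=\ddot x$ a.e.; the equation holds for almost all $t\ge t_0$; and the initial conditions hold. A point $x^*$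 is weakly Pareto optimal if there is no $x$ with $f_i(x)<f_i(x^* )$ for all $i$; $P_w$ denotes the set of such points. The merit function is $u_0(x)=\sup_{z\in\mathcal H}\min_i\big(f_i(x)-f_i(z)\big)$. For $\hat F\in\mathbb R^m$, $\mathcal L(\hat F)=\{x:F(x)\le\hat F\}$ and $P_w(\hat F)=P_w\cap\mathcal L(\hat F)$. Assumption: for all $x_0\in\mathcal H$ and all $x\in\mathcal L(F(x_0))$ there exists $x^*\in P_w(F(x))$, and $$R:=\sup_{F^*\in F(P_w(F(x_0)))}\ \inf_{x\in F^{-1}(F^* )}\tfrac12\|x-x_0\|^2<+\infty .$$ *)

(* Defs.v *)
From HB Require Import structures.
From mathcomp Require Import all_boot all_order all_algebra.
From mathcomp Require Import all_classical all_reals all_analysis.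
Set Implicit Arguments. Unset Strict Implicit. Unset Printing Implicit Defensive.
Import Order.TTheory GRing.Theory Num.Theory numFieldNormedType.Exports.
Local Open Scope classical_set_scope.
Local Open Scope ring_scope.

Section Defs.
Context {R : realType}.

Local Notation mu := (@lebesgue_measure R).

Section OnH.
Context {H : normedModType R}.

(* ip is an inner product inducing the norm of H (H complete => real Hilbert space) *)
Definition inner_product (ip : H -> H -> R) : Prop :=
  (forall x y, ip x y = ip y x) /\
  (forall (a : R) x y z, ip (a *: x + y) z = a * ip x z + ip y z) /\
  (forall x, `|x| ^+ 2 = ip x x).

Definition convex_fun (f : H -> R) : Prop :=
  forall x y (l : R), 0 <= l <= 1 ->
    f (l *: x + (1 - l) *: y) <= l * f x + (1 - l) * f y.

Definition gradient_of (ip : H -> H -> R) (f : H -> R) (g : H -> H) : Prop :=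
  forall x, differentiable f x /\ forall v, 'd f x v = ip (g x) v.

Definition conv_grads (m : nat) (g : 'I_m -> H -> H) (x : H) : set H :=
  [set w | exists lam : 'I_m -> R, (forall i, 0 <= lam i) /\
      \sum_(i < m) lam i = 1 /\ w = \sum_(i < m) lam i *: g i x].

Definition is_proj (K : set H) (y p : H) : Prop :=
  K p /\ forall w, K w -> `|p - y| <= `|w - y|.

Definition weakly_pareto (m : nat) (f : 'I_m -> H -> R) (xs : H) : Prop :=
  ~ exists z, forall i, f i z < f i xs.

Definition levelset (m : nat) (f : 'I_m -> H -> R) (Fh : 'I_m -> R) : set H :=
  [set x | forall i, f i x <= Fh i].

Definition u0 (m : nat) (f : 'I_m -> H -> R) (x : H) : \bar R :=
  ereal_sup [set \big[Order.min/(+oo)%E]_(i < m) (f i x - f i z)%:E | z in setT].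

(* R = sup over F* in F(P_w(F(x0))) of inf over x in F^{-1}(F* ) of 1/2 ||x - x0||^2 *)
Definition Rconst (m : nat) (f : 'I_m -> H -> R) (x0 : H) : \bar R :=
  ereal_sup [set ereal_inf
                  [set ((2^-1 * `|x - x0| ^+ 2)%:E) | x in
                     [set x | forall i, f i x = f i xs]]
            | xs in [set xs | weakly_pareto f xs /\
                              levelset f (fun i => f i x0) xs]].

Definition simple_fun (s : R -> H) : Prop :=
  exists n (A : 'I_n -> set R) (v : 'I_n -> H),
    (forall i, measurable (A i)) /\
    s = (fun t => \sum_(i < n) (\1_(A i) t) *: v i).

Definition strongly_measurable (D : set R) (f : R -> H) : Prop :=
  exists s : nat -> R -> H, (forall k, simple_fun (s k)) /\
    \forall t \ae mu, D t -> (fun k => s k t) @ \oo --> f t.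

Definition abs_continuous_on (a b : R) (f : R -> H) : Prop :=
  forall e : R, 0 < e -> exists2 d : R, 0 < d &
    forall n (u v : 'I_n -> R),
      (forall i, a <= u i /\ u i <= v i /\ v i <= b) ->
      (forall i j : 'I_n, (i < j)%N -> v i <= u j) ->
      \sum_(i < n) (v i - u i) < d ->
      \sum_(i < n) `|f (v i) - f (u i)| < e.

Definition solution (ip : H -> H -> R) (m : nat) (g : 'I_m -> H -> H)
    (alpha t0 : R) (x0 : H) (x xd : R -> H) : Prop :=
  (forall t, t0 < t -> is_derive t 1 x (xd t)) /\
  ((fun h => h^-1 *: (x (h + t0) - x t0)) @ at_right 0 --> xd t0) /\
  {within `[t0, +oo[, continuous xd} /\
  (forall T, t0 <= T -> abs_continuous_on t0 T xd) /\
  (exists xdd : R -> H,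
     strongly_measurable `[t0, +oo[ xdd /\
     (* xdot(t) = xdot(t0) + Bochner integral of xddot over [t0,t]
        (Bochner integrability, and the identity tested against every v) *)
     (forall t, t0 <= t ->
        mu.-integrable `[t0, t] (fun s => (`|xdd s|)%:E) /\
        forall v, ip (xd t - xd t0) v = \int[mu]_(s in `[t0, t]) ip (xdd s) v) /\
     (\forall t \ae mu, t0 < t -> is_derive t 1 xd (xdd t)) /\
     (\forall t \ae mu, t0 < t ->
        is_proj [set c + xdd t | c in conv_grads g (x t)] 0
                (- ((alpha / t) *: xd t)))) /\
  x t0 = x0 /\ xd t0 = 0.

End OnH.
End Defs.

(* Main.v *)
Require Import Defs.
From HB Require Import structures.
From mathcomp Require Import all_boot all_order all_algebra.
From mathcomp Require Import all_classical all_reals all_analysis.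
From mathcomp Require Import measurable_realfun ring lra.
Import Order.TTheory GRing.Theory Num.Theory numFieldNormedType.Exports.
Local Open Scope classical_set_scope.
Local Open Scope ring_scope.
Set Implicit Arguments. Unset Strict Implicit. Unset Printing Implicit Defensive.

(** For fixed [z], put [h t = min_i (f_i (x t) - f_i z)] and
      [E t = t^2 h t + 1/2 |2 (x t - z) + t x'(t)|^2 + (alpha - 3) |x t - z|^2].
    At almost every [t] the projection equation says that
    [x'' = - (alpha / t) x' - w] with [w] a convex combination of the gradients,
    and that [<grad f_i - w, x'> <= 0] for every [i]; with convexity of the
    [f_j] this gives [E' <= (3 - alpha) t |x'|^2], where the minimum is
    differentiated through an active index.  [E] being absolutely continuous,
    integration bounds [t^2 h t] by
      [t0^2 h t0 + (alpha - 1) |x0 - z|^2 + (3 - alpha) int s |x'|^2].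
    Since [f_i (x t) + 1/2 |x'(t)|^2] decreases, only points [z] below [F x0]
    matter for the supremum defining [u0 (x t)]; such a [z] may be replaced by a
    weak Pareto point below it, and then by any point with the same values,
    which turns [1/2 |x0 - z|^2] into the constant [R]. *)

(** * Monotonicity of absolutely continuous functions *)

(** Let [c] be the supremum of the [t] such that [P] holds on all of [[a, t]]. [Pleft] gives [P c],
    and if [c < b] then [Pright] carries [P] past [c], a contradiction. *)
Lemma real_induction (R : realType) (a b : R) (P : R -> Prop) :
  a <= b -> P a ->
  (forall t, a <= t -> t < b -> P t ->
    exists2 d, 0 < d & forall s, t < s -> s < t + d -> s <= b -> P s) ->
  (forall t, a < t -> t <= b -> (forall s, a <= s -> s < t -> P s) -> P t) ->
  P b.
Proof.
move=> ab Pa Pright Pleft.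
pose S := [set t | (a <= t /\ t <= b) /\ forall s, a <= s -> s <= t -> P s].
have Sa : S a.
  by split=> // s h1 h2; have -> : s = a by apply/eqP; rewrite eq_le h1 h2.
have Sub : ubound S b by move=> t [[]].
have hS : has_sup S by split; [exists a | exists b].
set c := sup S.
have ac : a <= c by apply: ub_le_sup => //; exists b.
have cb : c <= b by apply: ge_sup => //; exists a.
have Plt s : a <= s -> s < c -> P s.
  move=> as_ sc; have [t St st] := sup_gt hS.1 sc.
  by apply: St.2 => //; exact: ltW.
have Pc : P c.
  move: ac; rewrite le_eqVlt => /orP[/eqP<-//|ac]; exact: Pleft.
move: cb; rewrite le_eqVlt => /orP[/eqP<-//|cb].
have [d d0 Pd] := Pright c ac cb Pc.
pose e := Num.min b (c + d / 2).
have ce : c < e by rewrite lt_min cb ltrDl divr_gt0.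
suff Se : S e.
  have : e <= c by apply: ub_le_sup => //; exists b.
  by rewrite leNgt ce.
split; first by rewrite (ltW (le_lt_trans ac ce)) ge_min lexx.
move=> s as_ se; have [sc|cs] := ltP s c; first exact: Plt.
move: cs; rewrite le_eqVlt => /orP[/eqP<-//|cs].
apply: Pd => //; last by rewrite (le_trans se)// ge_min lexx.
apply: (le_lt_trans se); rewrite gt_min ltrD2l; apply/orP; right; lra.
Qed.

Section absolutely_continuous.
Context {R : realType}.
Local Notation mu := (@lebesgue_measure R).

(** Endpoints are indexed by [nat]: dropping the last interval changes only [n], appending one is a
    conditional, and values from index [n] on are irrelevant. Half-open intervals may abut and stay
    disjoint. *)
Definition chain (O : set R) (a t : R) n (u v : nat -> R) : Prop :=
  (forall i, (i < n)%N ->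
    [/\ a <= u i, u i <= v i, v i <= t & `[u i, v i[ `<=` O]) /\
  (forall i j, (i < j)%N -> (j < n)%N -> v i <= u j).

(** Induction on [n]: the last interval lies in [O] and is disjoint from []-oo, u n[], to which the
    earlier ones are confined. *)
Lemma chain_length O a t n u v : measurable O -> chain O a t n u v ->
  ((\sum_(i < n) (v i - u i))%:E <= mu (O `&` `]-oo, t[))%E.
Proof.
move=> mO; elim: n t => [|n IH] t [h1 h2].
  by rewrite big_ord0 measure_ge0.
have [aun uvn vnt uvO] := h1 n (ltnSn n).
have hn : chain O a (u n) n u v.
  split=> [i ni|i j ij jn]; last by apply: h2 => //; exact: ltnW.
  have [? ? _ ?] := h1 i (ltnW ni); split=> //; exact: h2.
rewrite big_ord_recr/= EFinD.
have m1 : measurable (O `&` `]-oo, u n[) by apply: measurableI.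
have -> : ((v n - u n)%:E = mu `[u n, v n[)%E.
  by rewrite lebesgue_measure_itv/= lte_fin; case: ltP => // vu; congr (_%:E); lra.
apply: (@le_trans _ _ (mu ((O `&` `]-oo, u n[) `|` `[u n, v n[)))%E.
  rewrite measureU//; first by rewrite leeD2r// IH.
  apply/seteqP; split=> [s|//]; rewrite /= !in_itv/= => -[[_ h] /andP[h' _]].
  by move: (lt_le_trans h h'); rewrite ltxx.
apply: le_measure; rewrite ?inE; [exact: measurableU|exact: measurableI|].
move=> s [[sO]|]; rewrite /= !in_itv/=.
  by move=> h; split=> //; rewrite (lt_le_trans h)// (le_trans uvn).
move=> /[dup] /andP[h3 h4] h; split; last exact: lt_le_trans vnt.
by apply: uvO; rewrite /= in_itv.
Qed.

(* The null set is covered by an open set of small measure: on it the growth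
   of phi is controlled by absolute continuity, off it by the right
   derivative, and real induction patches both estimates together. *)
Lemma ac_nonincreasing (V : normedModType R) (w : R -> V) (a b L : R)
    (phi : R -> R) :
  a <= b -> abs_continuous_on a b w -> 0 <= L ->
  (forall u v, a <= u -> u <= v -> v <= b ->
    `|phi v - phi u| <= L * ((v - u) + `|w v - w u|)) ->
  (\forall t \ae mu, a < t -> t < b -> forall e, 0 < e ->
    exists2 d, 0 < d &
      forall s, t < s -> s < t + d -> phi s - phi t <= e * (s - t)) ->
  phi b <= phi a.
Proof.
move=> ab acw L0 phiL [B [mB B0 subB]].
(* The slope costs [e * (b - a)]. One spare [e] is the slack [eta] of the invariant [P]; the other
   two bound the length of the chain and the variation of [w] over it, each times [L]. *)
suff H e : 0 < e -> phi b - phi a <= e * (b - a) + e + e + e.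
  apply/ler_addgt0Pl => e e0.
  have e30 : 0 < e / ((b - a) + 3) by rewrite divr_gt0//; lra.
  have H' := H _ e30.
  have E : e / ((b - a) + 3) * ((b - a) + 3) = e by rewrite divfK//; lra.
  lra.
move=> e0; set e' := e / (L + 1).
have L1 : 0 < L + 1 by lra.
have e'0 : 0 < e' by rewrite divr_gt0.
have Le' : L * e' <= e.
  have : (L + 1) * e' = e by rewrite mulrC divfK// gt_eqF.
  lra.
have [d d0 hd] := acw e' e'0.
pose d' := Num.min d e'.
have d'0 : 0 < d' by rewrite lt_min d0.
(* The point [a] joins the null set because the derivative hypothesis is silent at [t = a]. *)
pose N := B `|` [set a].
have mN : measurable N by apply: measurableU.
have N0 : mu N = 0%E.
  apply/eqP; rewrite eq_le measure_ge0 andbT.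
  apply: (le_trans (measureU2 _ mB _)) => //.
  by rewrite /= B0 lebesgue_measure_set1 adde0.
have [|O [oO NO Od]] := lebesgue_regularity_outer mN _ d'0.
  by rewrite /= N0 ltry.
have mO : measurable O by exact: measurable_realfun.open_measurable.
have muO : (mu O < d'%:E)%E.
  rewrite -(setDUK NO); apply: (le_lt_trans (measureU2 _ mN _)) => //=.
    exact: measurableD.
  by rewrite N0 add0e.
(* The slack [eta] is arbitrary so that passing to a left limit may spend half of it. *)
pose P t := forall eta, 0 < eta -> exists n u v, chain O a t n u v /\
  phi t - phi a <= e * (t - a) + eta +
     \sum_(i < n) L * ((v i - u i) + `|w (v i) - w (u i)|).
suff Pb : P b.
  have [n [u [v [ch le1]]]] := Pb e e0.
  apply: (le_trans le1).
  have len : \sum_(i < n) (v i - u i) < d'.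
    rewrite -lte_fin; apply: (le_lt_trans (chain_length mO ch)).
    apply: le_lt_trans muO; apply: le_measure; rewrite ?inE//.
    exact: measurableI.
  have var : \sum_(i < n) `|w (v i) - w (u i)| < e'.
    apply: (hd n (fun i => u i) (fun i => v i)).
    - by move=> i; have [] := ch.1 i (ltn_ord i).
    - by move=> i j ij; apply: ch.2.
    - by apply: (lt_le_trans len); rewrite ge_min lexx.
  rewrite -mulr_sumr big_split/= mulrDr.
  have l1 : L * \sum_(i < n) (v i - u i) <= e.
    apply: le_trans Le'; apply: ler_wpM2l => //; apply: ltW.
    by apply: (lt_le_trans len); rewrite ge_min lexx orbT.
  have l2 : L * \sum_(i < n) `|w (v i) - w (u i)| <= e.
    by apply: le_trans Le'; apply: ler_wpM2l => //; exact: ltW.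
  lra.
apply: (@real_induction _ a b) => //.
- move=> eta eta0; exists 0%N, (fun=> 0), (fun=> 0); split; first by split.
  by rewrite big_ord0; lra.
- move=> t at_ tb Pt.
  (* On [N] the interval [[t, s[] is appended to the chain, since [O] is a neighbourhood of [t]; off
     [N] the chain is kept and the slope [e] pays. *)
  have [Nt|Nt] := pselect (N t).
    have /nbhs_ballP[r r0 tO] : nbhs t O by apply: open_nbhs_nbhs; split=> //; exact: NO.
    exists r => // s ts sr sb eta eta0.
    have [n [u [v [ch le1]]]] := Pt eta eta0.
    exists n.+1, (fun i => if (i < n)%N then u i else t),
      (fun i => if (i < n)%N then v i else s); split.
      split=> [i ni|i j ij jn].
        case: ifPn => [hi|_].
          have [? ? vt ?] := ch.1 i hi; split=> //.
          by rewrite (le_trans vt)// ltW.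
        split=> //; first exact: ltW.
        move=> y; rewrite /= in_itv/= => /andP[ty ys]; apply: tO.
        by rewrite /ball/= ltr_norml; apply/andP; split; lra.
      have hi : (i < n)%N by apply: leq_trans ij _.
      rewrite hi; case: ifPn => hj; first exact: ch.2.
      by have [_ _] := ch.1 i hi.
    rewrite big_ord_recr/= ltnn.
    have -> : \sum_(i < n) L * ((if (i < n)%N then v i else s) -
        (if (i < n)%N then u i else t) +
        `|w (if (i < n)%N then v i else s) - w (if (i < n)%N then u i else t)|) =
       \sum_(i < n) L * ((v i - u i) + `|w (v i) - w (u i)|).
      by apply: eq_bigr => i _; rewrite ltn_ord.
    have := phiL t s at_ (ltW ts) sb; have := ler_norm (phi s - phi t).
    have : 0 <= e * (s - t) by rewrite mulr_ge0; lra.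
    lra.
  have at' : a < t.
    rewrite lt_neqAle at_ andbT; apply/eqP => Ea; apply: Nt; right => /=; exact/esym.
  have Ct : forall e, 0 < e -> exists2 d, 0 < d &
      forall s, t < s -> s < t + d -> phi s - phi t <= e * (s - t).
    apply: contrapT => nC; apply: Nt; left; apply: subB => /= hC.
    by apply: nC; exact: hC.
  have [r r0 hr] := Ct e e0.
  exists r => // s ts sr sb eta eta0.
  have [n [u [v [ch le1]]]] := Pt eta eta0.
  exists n, u, v; split.
    split; last exact: ch.2.
    move=> i ni; have [? ? vt ?] := ch.1 i ni; split=> //.
    by rewrite (le_trans vt)// ltW.
  have := hr s ts sr; lra.
(* A point [s] is taken so close to [t] that, by [phiL] and the continuity of [w], the jump from [s]
   to [t] costs at most [eta / 2]; the other half goes to [P s]. *)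
- move=> t at_ tb Pt eta eta0.
  pose e1 := eta / 2 / (2 * (L + 1)).
  have e10 : 0 < e1 by rewrite !divr_gt0// mulr_gt0.
  have Le1 : L * (e1 + e1) <= eta / 2.
    have : e1 * (2 * (L + 1)) = eta / 2 by rewrite divfK// mulf_neq0// gt_eqF.
    lra.
  have [r r0 hr] := acw e1 e10.
  pose s := Num.max a (t - Num.min r e1 / 2).
  have m0 : 0 < Num.min r e1 by rewrite lt_min r0.
  have as_ : a <= s by rewrite le_max lexx.
  have st : s < t by rewrite gt_max at_; lra.
  have ts : t - s < Num.min r e1.
    have : t - Num.min r e1 / 2 <= s by rewrite le_max lexx orbT.
    lra.
  have eta20 : 0 < eta / 2 by rewrite divr_gt0.
  have [n [u [v [ch le1]]]] := Pt s as_ st (eta / 2) eta20.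
  exists n, u, v; split.
    split; last exact: ch.2.
    move=> i ni; have [? ? vt ?] := ch.1 i ni; split=> //.
    by rewrite (le_trans vt)// ltW.
  have := phiL s t as_ (ltW st) tb; have := ler_norm (phi t - phi s).
  have : 0 <= e * (t - s) by rewrite mulr_ge0; lra.
  have [tsr tse] : t - s < r /\ t - s < e1 by move: ts; rewrite lt_min => /andP[].
  have wts : `|w t - w s| < e1.
    have := hr 1%N (fun=> s) (fun=> t); rewrite !big_ord1; apply => //.
      by move=> _; rewrite as_ (ltW st) tb.
    by move=> i j; rewrite !ord1.
  have : L * (t - s + `|w t - w s|) <= L * (e1 + e1).
    by apply: ler_wpM2l => //; lra.
  lra.
Qed.

End absolutely_continuous.

(** * Inner products *)

Section inner_product_theory.
Context {R : realType} {H : normedModType R} (ip : H -> H -> R).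
Hypothesis ipP : inner_product ip.

Lemma ipC u v : ip u v = ip v u.
Proof. by case: ipP => + _; apply. Qed.

Lemma normr2_ip u : `|u| ^+ 2 = ip u u.
Proof. by case: ipP => _ [_]; apply. Qed.

Lemma ipDl u v z : ip (u + v) z = ip u z + ip v z.
Proof. by case: ipP => _ [h _]; have := h 1 u v z; rewrite scale1r mul1r. Qed.

Lemma ip0l z : ip 0 z = 0.
Proof. by have := ipDl 0 0 z; rewrite addr0; lra. Qed.

Lemma ipZl k u z : ip (k *: u) z = k * ip u z.
Proof. by case: ipP => _ [h _]; have := h k u 0 z; rewrite ip0l !addr0. Qed.

Lemma ipNl u z : ip (- u) z = - ip u z.
Proof. by rewrite -scaleN1r ipZl mulN1r. Qed.

Lemma ipBl u v z : ip (u - v) z = ip u z - ip v z.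
Proof. by rewrite ipDl ipNl. Qed.

Lemma ipDr z u v : ip z (u + v) = ip z u + ip z v.
Proof. by rewrite ipC ipDl !(ipC z). Qed.

Lemma ipZr k z u : ip z (k *: u) = k * ip z u.
Proof. by rewrite ipC ipZl (ipC z). Qed.

Lemma ipNr z u : ip z (- u) = - ip z u.
Proof. by rewrite ipC ipNl (ipC z). Qed.

Lemma ipBr z u v : ip z (u - v) = ip z u - ip z v.
Proof. by rewrite ipC ipBl !(ipC z). Qed.

Lemma ip_suml n (F : 'I_n -> H) z : ip (\sum_(i < n) F i) z = \sum_(i < n) ip (F i) z.
Proof.
by apply: (big_morph (ip^~ z)) => [u v|]; [exact: ipDl|exact: ip0l].
Qed.

Lemma normrD2_ip u v : `|u + v| ^+ 2 = `|u| ^+ 2 + 2 * ip u v + `|v| ^+ 2.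
Proof. by rewrite !normr2_ip ipDl !ipDr (ipC v u); ring. Qed.

(** Reduces the continuity of [ip] to that of the norm. *)
Lemma ip_polarization u v : ip u v = 4^-1 * (`|u + v| ^+ 2 - `|u - v| ^+ 2).
Proof. by rewrite !normrD2_ip normrN ipNr; field. Qed.

(** Cauchy-Schwarz follows from the triangle inequality of the norm: after squaring, only the cross
    terms differ. *)
Lemma ip_le_norm u v : ip u v <= `|u| * `|v|.
Proof.
have := ler_normD u v; rewrite -(@ler_pXn2r _ 2)// ?nnegrE ?addr_ge0//.
by rewrite normrD2_ip sqrrD -mulr_natl => h; nra.
Qed.

Lemma normr_ip_le u v : `|ip u v| <= `|u| * `|v|.
Proof.
rewrite ler_norml ip_le_norm andbT lerNl -ipNl.
by apply: (le_trans (ip_le_norm _ _)); rewrite normrN.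
Qed.

Lemma cvg_ip (T : Type) (F : set_system T) (FF : Filter F) (p q : T -> H) u v :
  p @ F --> u -> q @ F --> v -> (fun t => ip (p t) (q t)) @ F --> ip u v.
Proof.
move=> pu qv; rewrite ip_polarization.
under eq_fun do rewrite ip_polarization.
have c w (z : T -> H) : z @ F --> w -> (fun t => `|z t| ^+ 2) @ F --> `|w| ^+ 2.
  by move=> zw; apply: cvgM; exact: cvg_norm.
apply: cvgM; first exact: cvg_cst.
by apply: cvgB; apply: c; [exact: cvgD|exact: cvgB].
Qed.

Lemma is_derive_ip (p q : R -> H) (t : R) (dp dq : H) :
  is_derive t 1 p dp -> is_derive t 1 q dq ->
  is_derive t 1 (fun s => ip (p s) (q s)) (ip dp (q t) + ip (p t) dq).
Proof.
move=> [dp1 dp2] [dq1 dq2].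
suff cv : (fun h : R => h^-1 *: (((fun s => ip (p s) (q s)) \o shift t) (h *: 1)
    - ip (p t) (q t))) @ 0^' --> ip dp (q t) + ip (p t) dq.
  by split; [apply/cvg_ex; eexists; exact: cv|exact: cvg_lim].
have -> : (fun h : R => h^-1 *: (((fun s => ip (p s) (q s)) \o shift t) (h *: 1)
    - ip (p t) (q t))) =
  (fun h : R => ip (h^-1 *: ((p \o shift t) (h *: 1) - p t)) ((q \o shift t) (h *: 1))
     + ip (p t) (h^-1 *: ((q \o shift t) (h *: 1) - q t))).
  apply/funext => h /=; rewrite ipZl ipZr ipBl ipBr -mulrDr.
  by rewrite /GRing.scale/=; congr (_ * _); ring.
have cq : (q \o shift t) (h *: 1) @[h --> 0^'] --> q t.
  have /derivable1_diffP/differentiable_continuous cq := dq1.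
  apply: cvg_within_filter.
  have -> : (fun h : R => (q \o shift t) (h *: 1)) = q \o (fun h => h + t).
    by apply/funext => h /=; rewrite /GRing.scale/= mulr1.
  apply: continuous_cvg; first exact: cq.
  by rewrite -[X in _ --> X]add0r; apply: cvgD; [exact: cvg_id|exact: cvg_cst].
apply: cvgD; apply: cvg_ip => //.
- by rewrite -dp2; exact: dp1.
- exact: cvg_cst.
- by rewrite -dq2; exact: dq1.
Qed.

Lemma is_derive_gradient (f : H -> R) g (p : R -> H) (t : R) (dp : H) :
  gradient_of ip f g -> is_derive t 1 p dp ->
  is_derive t 1 (f \o p) (ip (g (p t)) dp).
Proof.
move=> fg [dp1 dp2]; have [df E] := fg (p t).
have difp : differentiable p t by exact/derivable1_diffP.
have dfp : differentiable (f \o p) t by exact: differentiable_comp.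
split; first exact/derivable1_diffP.
by rewrite deriveE// diff_comp//= -E -dp2 deriveE.
Qed.

(** By convexity the difference quotients in direction [z - x] with step [0 < h <= 1] are at most
    [f z - f x]; let [h] tend to 0 from the right. *)
Lemma convex_gradient_le (f : H -> R) g x z :
  convex_fun f -> gradient_of ip f g -> ip (g x) (z - x) <= f z - f x.
Proof.
move=> cf fg; have [df <-] := fg x.
rewrite -deriveE//; have dv := @diff_derivable _ _ _ _ _ (z - x) df.
have cv : h^-1 *: ((f \o shift x) (h *: (z - x)) - f x) @[h --> 0^'+] -->
    'D_(z - x) f x.
  exact: cvg_dnbhs_at_right.
apply: (cvgr_to_le cv); near=> h.
have h0 : 0 < h by near: h; exact: nbhs_right_gt.
have h1 : h <= 1 by near: h; exact: nbhs_right_le.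
have -> : (f \o shift x) (h *: (z - x)) = f (h *: z + (1 - h) *: x).
  by rewrite /= scalerBr scalerBl scale1r -addrA addrC (addrC (- _)) addrC.
rewrite /GRing.scale/= ler_pdivrMl//.
have := cf z x h; rewrite h1 ltW// => /(_ isT); lra.
Unshelve. all: by end_near. Qed.

(** With [d] the difference of [G i + c] and [p], the points [p + s *: d], [0 <= s <= 1], stay in
    the translated hull, so minimality of [p] forbids a negative first-order term in [s]. *)
Lemma proj_variational m (G : 'I_m -> H) (c p : H) :
  is_proj [set w + c | w in [set w | exists lam : 'I_m -> R,
     (forall i, 0 <= lam i) /\ \sum_(i < m) lam i = 1 /\
     w = \sum_(i < m) lam i *: G i]] 0 p ->
  forall i, 0 <= ip p (G i + c - p).
Proof.
move=> [[w0 [lam [lam0 [lam1 w0E]]] pE] pmin] i.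
rewrite leNgt; apply/negP => neg.
set d := G i + c - p in neg *.
have key s : 0 <= s <= 1 -> 0 <= 2 * s * ip p d + s ^+ 2 * `|d| ^+ 2.
  move=> /andP[s0 s1].
  have : `|p - 0| <= `|(p + s *: d) - 0|.
    apply: pmin; exists ((1 - s) *: w0 + s *: G i); last first.
      rewrite /d -pE opprD addrACA subrr addr0 scalerBl scale1r scalerBr.
      by rewrite -!addrA; congr (_ + _); rewrite addrC -addrA addrCA.
    exists (fun j => (1 - s) * lam j + s * (j == i)%:R); split; [|split].
    - by move=> j; rewrite addr_ge0// mulr_ge0// subr_ge0.
    - rewrite big_split/= -!mulr_sumr lam1 (bigD1 i)//= eqxx big1 => [|j /negPf->//].
      by rewrite addr0 !mulr1 subrK.
    - under eq_bigr do rewrite scalerDl -!scalerA.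
      rewrite big_split/= -!scaler_sumr -w0E; congr (_ + _ *: _).
      rewrite (bigD1 i)//= eqxx scale1r big1 ?addr0// => j /negPf->.
      by rewrite scale0r.
  rewrite !subr0 -(@ler_pXn2r _ 2)// ?nnegrE// normrD2_ip ipZr normrZ exprMn.
  rewrite ger0_norm//; lra.
have d0 : 0 < `|d| ^+ 2 + 1 - ip p d by have := sqr_ge0 `|d|; lra.
(* This step makes [s * |d|^2] smaller than [- ip p d], so [2 * ip p d + s * |d|^2] is still
   negative. *)
pose s := (- ip p d) / (`|d| ^+ 2 + 1 - ip p d).
have sE : s * (`|d| ^+ 2 + 1 - ip p d) = - ip p d by rewrite divfK// gt_eqF.
have s0 : 0 < s by rewrite divr_gt0// oppr_gt0.
have s1 : s <= 1 by rewrite ler_pdivrMr// mul1r; have := sqr_ge0 `|d|; lra.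
have := key s; rewrite s1 ltW// => /(_ isT).
have -> : 2 * s * ip p d + s ^+ 2 * `|d| ^+ 2 =
  s * (2 * ip p d + s * `|d| ^+ 2) by ring.
rewrite pmulr_rge0//.
have : 0 < s * (1 - ip p d) by rewrite mulr_gt0//; lra.
lra.
Qed.

End inner_product_theory.

(** * Curves and their moduli *)

Section real_curves.
Context {R : realType}.
Local Notation mu := (@lebesgue_measure R).

(* Only an upper envelope touching at [t] is differentiated, so that [phi] may
   be a minimum of differentiable functions. *)
Lemma right_growth_le_derive (phi psi : R -> R) (t d : R) :
  is_derive t 1 psi d -> d <= 0 -> phi t = psi t ->
  (forall s, phi s <= psi s) ->
  forall e, 0 < e -> exists2 r, 0 < r &
    forall s, t < s -> s < t + r -> phi s - phi t <= e * (s - t).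
Proof.
move=> [dpsi Ed] d0 pt ps e e0.
have cv : h^-1 *: ((psi \o shift t) (h *: 1) - psi t) @[h --> 0^'+] --> d.
  by apply: cvg_dnbhs_at_right; rewrite -Ed; exact: dpsi.
have de : d < e by exact: le_lt_trans e0.
have [r /= r0 hr] := cvgr_le _ cv _ de.
exists r => // s ts sr.
have st0 : 0 < s - t by rewrite subr_gt0.
have := hr (s - t); rewrite /= sub0r normrN gtr0_norm// => /(_ _ st0).
have -> : (s - t < r) by lra.
move=> /(_ isT); rewrite /GRing.scale/= mulr1 subrK ler_pdivrMl//.
have := ps s; lra.
Qed.

Lemma within_continuous_bounded (V : normedModType R) (a b : R) (p : R -> V) :
  {within `[a, b], continuous p} ->
  exists2 M, 0 <= M & forall t, a <= t -> t <= b -> `|p t| <= M.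
Proof.
move=> cp.
have /compact_bounded[M [_ hM]] := continuous_compact cp (@segment_compact _ a b).
exists (Num.max 0 (M + 1)); first by rewrite le_max lexx.
move=> t ta tb; apply: hM; first by rewrite lt_max ltrDl ltr01 orbT.
by exists t => //=; rewrite in_itv/= ta tb.
Qed.

Lemma derive_bounded_lipschitz (a b M : R) (p dp : R -> R) :
  {within `[a, b], continuous p} ->
  (forall t : R, a < t -> t < b -> is_derive t 1 p (dp t)) ->
  (forall t, a <= t -> t <= b -> `|dp t| <= M) ->
  forall u v, a <= u -> u <= v -> v <= b -> `|p v - p u| <= M * (v - u).
Proof.
move=> cp derp bdp u v au uv vb.
have [] := @MVT_segment _ p dp u v uv.
- move=> t; rewrite in_itv/= => /andP[ut tv].
  by apply: derp; [exact: le_lt_trans ut|exact: lt_le_trans vb].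
- apply: continuous_subspaceW cp => t; rewrite /= !in_itv/= => /andP[h1 h2].
  by rewrite (le_trans au)//= (le_trans h2).
move=> c; rewrite in_itv/= => /andP[uc cv] ->.
rewrite normrM (@ger0_norm _ (v - u)) ?subr_ge0//.
apply: ler_wpM2r; rewrite ?subr_ge0//; apply: bdp.
  exact: le_trans uc.
exact: le_trans vb.
Qed.

(** The mean value theorem is scalar, so it is applied to [ip (p t) w] with [w] the increment of
    [p]; a factor [|w|] then cancels. *)
Lemma derive_bounded_lipschitz_ip (H : normedModType R) (ip : H -> H -> R)
    (a b M : R) (p dp : R -> H) : inner_product ip ->
  {within `[a, b], continuous p} ->
  (forall t : R, a < t -> t < b -> is_derive t 1 p (dp t)) ->
  (forall t, a <= t -> t <= b -> `|dp t| <= M) ->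
  forall u v, a <= u -> u <= v -> v <= b -> `|p v - p u| <= M * (v - u).
Proof.
move=> ipP cp derp bdp u v au uv vb.
set w := p v - p u.
have [->|w0] := eqVneq w 0.
  rewrite normr0 mulr_ge0 ?subr_ge0//.
  exact: le_trans (normr_ge0 _) (bdp u au (le_trans uv vb)).
have wp : 0 < `|w| by rewrite normr_gt0.
have := @derive_bounded_lipschitz a b (M * `|w|) (fun t => ip (p t) w)
   (fun t => ip (dp t) w) _ _ _ u v au uv vb.
rewrite -(ipBl ipP) -/w -(normr2_ip ipP) ger0_norm ?sqr_ge0//.
have -> : M * `|w| * (v - u) = `|w| * (M * (v - u)) by ring.
rewrite expr2 ler_pM2l//; apply.
- by move=> t; apply: (cvg_ip ipP); [exact: cp|exact: cvg_cst].
- move=> t at_ tb.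
  have := is_derive_ip ipP (derp t at_ tb) (is_derive_cst w (t : R^o) 1).
  by rewrite -[ip (p t) 0](ipC ipP) (ip0l ipP) addr0.
- move=> t at_ tb; apply: (le_trans (normr_ip_le ipP _ _)).
  by apply: ler_wpM2r => //; exact: bdp.
Qed.

Section wlip.
Variables (om : R -> R -> R) (a b : R).

(* Boundedness is included so that the class is stable under products. *)
Definition wlip (V : normedModType R) (p : R -> V) : Prop :=
  exists L M, [/\ 0 <= L, 0 <= M,
    (forall t, a <= t -> t <= b -> `|p t| <= M) &
    (forall u v, a <= u -> u <= v -> v <= b -> `|p v - p u| <= L * om u v)].

Lemma wlipD (V : normedModType R) (p q : R -> V) :
  wlip p -> wlip q -> wlip (fun t => p t + q t).
Proof.
move=> [L [M [L0 M0 bp lp]]] [L' [M' [L'0 M'0 bq lq]]].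
exists (L + L'), (M + M'); split; rewrite ?addr_ge0//.
- by move=> t ta tb; rewrite (le_trans (ler_normD _ _))// lerD ?bp ?bq.
- move=> u v au uv vb; rewrite mulrDl opprD addrACA.
  by rewrite (le_trans (ler_normD _ _))// lerD ?lp ?lq.
Qed.

(** Serves both the product of reals and the inner product: the increment splits as in the product
    rule, one factor being bounded and the other controlled by [om]. *)
Lemma wlip_bilinear (U V W : normedModType R) (B : U -> V -> W) p q :
  (forall x y, `|B x y| <= `|x| * `|y|) ->
  (forall x x' y, B (x - x') y = B x y - B x' y) ->
  (forall x y y', B x (y - y') = B x y - B x y') ->
  wlip p -> wlip q -> wlip (fun t => B (p t) (q t)).
Proof.
move=> Bn Bl Br [L [M [L0 M0 bp lp]]] [L' [M' [L'0 M'0 bq lq]]].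
exists (L * M' + M * L'), (M * M'); split; rewrite ?addr_ge0 ?mulr_ge0//.
- by move=> t ta tb; rewrite (le_trans (Bn _ _))// ler_pM ?bp ?bq.
- move=> u v au uv vb.
  have -> : B (p v) (q v) - B (p u) (q u) = B (p v - p u) (q v) + B (p u) (q v - q u).
    by rewrite Bl Br addrA subrK.
  rewrite (le_trans (ler_normD _ _))// mulrDl lerD// (le_trans (Bn _ _))//.
    rewrite mulrAC; apply: ler_pM => //; first exact: lp.
    by apply: bq => //; exact: le_trans uv.
  rewrite -mulrA; apply: ler_pM => //; last exact: lq.
  by apply: bp => //; exact: le_trans vb.
Qed.

Lemma wlipM (p q : R -> R) : wlip p -> wlip q -> wlip (fun t => p t * q t).
Proof.
apply: wlip_bilinear => [x y|x x' y|x y y']; first by rewrite normrM.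
- exact: mulrBl.
- exact: mulrBr.
Qed.

Lemma wlip_ip (H : normedModType R) (ip : H -> H -> R) p q :
  inner_product ip -> wlip p -> wlip q -> wlip (fun t => ip (p t) (q t)).
Proof.
move=> ipP; apply: wlip_bilinear.
- exact: normr_ip_le.
- exact: ipBl.
- exact: ipBr.
Qed.

Lemma wlip_lipschitz (V : normedModType R) (p : R -> V) (M : R) :
  (forall u v, v - u <= om u v) -> a <= b -> 0 <= M ->
  (forall u v, a <= u -> u <= v -> v <= b -> `|p v - p u| <= M * (v - u)) ->
  wlip p.
Proof.
move=> hom ab M0 lp; exists M, (`|p a| + M * (b - a)); split=> //.
- by rewrite addr_ge0// mulr_ge0// subr_ge0.
- move=> t ta tb; have := lp a t (lexx _) ta tb.
  have := ler_normD (p t - p a) (p a); rewrite subrK.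
  have : M * (t - a) <= M * (b - a) by apply: ler_wpM2l => //; lra.
  lra.
- move=> u v au uv vb; apply: (le_trans (lp u v au uv vb)).
  exact: ler_wpM2l.
Qed.

(** The increment from [u] to [v] is bounded above by that of the index active at [u] and below by
    that of the index active at [v]. Summing the constants serves all indices at once. *)
Lemma wlip_min n (F : 'I_n -> R -> R) (h : R -> R) :
  (forall u v, u <= v -> 0 <= om u v) ->
  (forall i, wlip (F i)) -> (forall i t, h t <= F i t) ->
  (forall t, exists i, h t = F i t) -> wlip h.
Proof.
move=> om0 /choice[L /choice[M hLM]] hF hex.
have L0 i : 0 <= L i by have [] := hLM i.
have M0 i : 0 <= M i by have [] := hLM i.
have Lsum i : L i <= \sum_(j < n) L j.
  by rewrite (bigD1 i)//= lerDl sumr_ge0.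
exists (\sum_(i < n) L i), (\sum_(i < n) M i); split.
- exact: sumr_ge0.
- exact: sumr_ge0.
- move=> t ta tb; have [i ->] := hex t.
  have [_ _ h1 _] := hLM i; apply: (le_trans (h1 t ta tb)).
  by rewrite (bigD1 i)//= lerDl sumr_ge0.
- move=> u v au uv vb.
  have bnd i : `|F i v - F i u| <= (\sum_(i < n) L i) * om u v.
    have [_ _ _ h2] := hLM i; apply: (le_trans (h2 u v au uv vb)).
    by apply: ler_wpM2r => //; exact: om0.
  have [i Ei] := hex u; have [j Ej] := hex v.
  rewrite ler_norml; apply/andP; split.
    have := bnd j; rewrite ler_norml => /andP[+ _]; have := hF j u; lra.
  have := bnd i; rewrite ler_norml => /andP[_]; have := hF i v; lra.
Qed.

End wlip.

Lemma ray_continuous_segment (V : normedModType R) (a b : R) (p : R -> V) :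
  {within `[a, +oo[, continuous p} -> {within `[a, b], continuous p}.
Proof.
apply: continuous_subspaceW => t; rewrite /= !in_itv/= => /andP[-> //].
Qed.

Lemma ray_continuous_integrable (p : R -> R) (a b : R) :
  {within `[a, +oo[, continuous p} -> mu.-integrable `[a, b] (EFin \o p).
Proof.
move=> cp; apply: continuous_compact_integrable; first exact: segment_compact.
exact: ray_continuous_segment cp.
Qed.

Lemma is_derive_integral (p : R -> R) (a t : R) :
  {within `[a, +oo[, continuous p} -> a < t ->
  is_derive t 1 (fun t => \int[mu]_(s in `[a, t]) p s) (p t).
Proof.
move=> cp at_.
have /continuous_within_itvcyP[cpo _] := cp.
(* Integrating up to [t + 1] makes [t] an interior point. *)
have tt1 : t < t + 1 by rewrite ltrDl.
have [|d E] := @continuous_FTC1_closed R p a t (t + 1) tt1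
  (ray_continuous_integrable _ cp) at_.
  by apply: cpo; rewrite in_itv/= at_.
by split=> //; rewrite -derive1E.
Qed.

End real_curves.

(** * The inertial system *)

Section pointwise_derive.
Context {R : realType}.

Lemma is_derive_fctD (p q : R -> R) (t dp dq : R) :
  is_derive t 1 p dp -> is_derive t 1 q dq ->
  is_derive t 1 (fun s => p s + q s) (dp + dq).
Proof. by move=> hp hq; exact: is_deriveD. Qed.

Lemma is_derive_fctM (p q : R -> R) (t dp dq : R) :
  is_derive t 1 p dp -> is_derive t 1 q dq ->
  is_derive t 1 (fun s => p s * q s) (dp * q t + p t * dq).
Proof.
move=> hp hq; have -> : dp * q t + p t * dq = p t *: dq + q t *: dp.
  by rewrite /GRing.scale/=; ring.
exact: (is_deriveM hp hq).
Qed.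

Lemma is_derive_fctZ (k : R) (p : R -> R) (t dp : R) :
  is_derive t 1 p dp -> is_derive t 1 (fun s => k * p s) (k * dp).
Proof. by move=> hp; exact: is_deriveZ. Qed.

Lemma is_derive_fctBcst (V : normedModType R) (c : V) (p : R -> V) (t : R) (dp : V) :
  is_derive t 1 p dp -> is_derive t 1 (fun s => p s - c) dp.
Proof.
move=> hp; rewrite -[dp]subr0.
exact: (is_deriveB hp (is_derive_cst c (t : R) 1)).
Qed.

(** A solution has only a one-sided difference quotient at [t0]; multiplying it by [s - t] yields
    the continuity of the position there. *)
Lemma right_derivable_cvg (V : normedModType R) (p : R -> V) (t : R) (d : V) :
  (fun h => h^-1 *: (p (h + t) - p t)) @ at_right 0 --> d ->
  p s @[s --> t^'+] --> p t.
Proof.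
move=> cq.
have cs : (fun s : R => s - t) @ t^'+ --> 0^'+.
  move=> A [r /= r0 hr]; exists r => //= s; rewrite /ball/= => sr st.
  by apply: hr; rewrite /= ?subr_gt0// sub0r normrN distrC.
have cv : (s - t) *: ((s - t)^-1 *: (p ((s - t) + t) - p t)) + p t @[s --> t^'+]
    --> 0 *: d + p t.
  apply: cvgD; last exact: cvg_cst.
  apply: cvgZ; last exact: cvg_comp cs cq.
  apply: cvg_trans (cvg_within _); exact: cs.
rewrite scale0r add0r in cv; apply: cvg_trans cv; apply: near_eq_cvg.
near=> s.
have st : 0 < s - t by rewrite subr_gt0; near: s; exact: nbhs_right_gt.
by rewrite scalerA divff ?gt_eqF// scale1r !subrK.
Unshelve. all: by end_near. Qed.

End pointwise_derive.

Section inertial_system.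
Context {R : realType} {H : normedModType R} (ip : H -> H -> R) (m : nat).
Context (f : 'I_m -> H -> R) (g : 'I_m -> H -> H).
Context (alpha t0 : R) (x0 : H) (x xd : R -> H).
Hypothesis ipP : inner_product ip.
Hypothesis f_convex : forall i, convex_fun (f i).
Hypothesis fg : forall i, gradient_of ip (f i) (g i).
Hypothesis g_cont : forall i, continuous (g i).
Hypothesis alpha_ge3 : 3 <= alpha.
Hypothesis t0_gt0 : 0 < t0.
Hypothesis sol : solution ip g alpha t0 x0 x xd.
Local Notation mu := (@lebesgue_measure R).

(** The velocity is absolutely continuous but perhaps not Lipschitz, so increments are measured
    against time plus the increment of [xd], the form accepted by [ac_nonincreasing]. *)
Let om (u v : R) : R := (v - u) + `|xd v - xd u|.

Let om_ge u v : v - u <= om u v.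
Proof. by rewrite lerDl. Qed.

Let om_ge0 u v : u <= v -> 0 <= om u v.
Proof. by move=> uv; rewrite addr_ge0// subr_ge0. Qed.

Lemma is_derive_position (t : R) : t0 < t -> is_derive t 1 x (xd t).
Proof. by case: sol => + _; apply. Qed.

Lemma velocity_continuous : {within `[t0, +oo[, continuous xd}.
Proof. by case: sol => _ [_ []]. Qed.

Lemma position_continuous : {within `[t0, +oo[, continuous x}.
Proof.
have [dx [qx _]] := sol.
apply/continuous_within_itvcyP; split; last exact: right_derivable_cvg qx.
move=> t; rewrite in_itv/= andbT => t0t.
by apply: differentiable_continuous; apply/derivable1_diffP; case: (dx t t0t).
Qed.

Lemma speed_continuous : {within `[t0, +oo[, continuous (fun s => s * `|xd s| ^+ 2)}.
Proof.
move=> t; apply: cvgM.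
  by apply: (@continuous_subspaceT R R _ id) => s; exact: cvg_id.
by apply: cvgM; apply: cvg_norm; exact: velocity_continuous.
Qed.

(* The two consequences of the projection equation: optimality of the
   projection, and its membership in the translated convex hull. *)
Lemma ae_acceleration : \forall t \ae mu, t0 < t -> exists acc : H,
  [/\ is_derive t 1 xd acc,
      forall i, ip (g i (x t)) (xd t) + ip acc (xd t) +
         alpha / t * ip (xd t) (xd t) <= 0 &
      exists lam : 'I_m -> R, [/\ forall i, 0 <= lam i, \sum_(i < m) lam i = 1 &
        acc = - (alpha / t *: xd t) - \sum_(i < m) lam i *: g i (x t)]].
Proof.
have [_ [_ [_ [_ [[xdd [_ [_ [dxd proj]]]] _]]]]] := sol.
move: dxd proj; apply: filterS2; first exact: (ae_filter_ringOfSetsType mu).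
move=> t + + t0t => /(_ t0t) dxd /(_ t0t) prj.
exists (xdd t); split=> //.
  (* The projection is [- (alpha / t) *: xd t]; its positive factor [alpha / t] is divided out of
     the variational inequality. *)
  move=> i; have := proj_variational ipP prj i.
  rewrite opprK (ipNl ipP) (ipZl ipP) (ipC ipP) !(ipDl ipP) (ipZl ipP).
  have al : 0 < alpha / t.
    apply: divr_gt0; last exact: lt_trans t0t.
    by apply: lt_le_trans alpha_ge3.
  by rewrite oppr_ge0 pmulr_rle0.
have [[w [lam [lam0 [lam1 ->]]] <-] _] := prj.
by exists lam; split=> //; rewrite addrAC subrr add0r.
Qed.

(** * Energy estimates on a bounded time interval *)

Section segment.
Variable T : R.
Hypothesis t0T : t0 <= T.

Let ac_xd : abs_continuous_on t0 T xd.
Proof. by case: sol => _ [_ [_ [h _]]]; exact: h. Qed.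

Let wlip_id : wlip om t0 T (id : R -> R).
Proof.
apply: (@wlip_lipschitz _ _ _ _ _ _ 1) => //= u v _ uv _.
by rewrite mul1r ger0_norm ?subr_ge0.
Qed.

Let wlip_cst (k : R) : wlip om t0 T (fun=> k).
Proof.
apply: (@wlip_lipschitz _ _ _ _ _ _ 0) => //= u v _ uv _.
by rewrite subrr normr0 mul0r.
Qed.

Let wlip_xd : wlip om t0 T xd.
Proof.
have [M M0 hM] := within_continuous_bounded (ray_continuous_segment (b := T) velocity_continuous).
exists 1, M; split=> // u v _ uv _.
by rewrite mul1r lerDr subr_ge0.
Qed.

Let wlip_x z : wlip om t0 T (fun s => x s - z).
Proof.
have [M M0 hM] := within_continuous_bounded (ray_continuous_segment (b := T) velocity_continuous).
apply: (@wlip_lipschitz _ _ _ _ _ _ M) => // u v t0u uv vT.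
rewrite opprB addrA subrK.
apply: (derive_bounded_lipschitz_ip ipP _ _ hM) => //.
  exact: ray_continuous_segment position_continuous.
by move=> t t0t _; exact: is_derive_position.
Qed.

Let wlip_f i (c : R) : wlip om t0 T (fun s => f i (x s) - c).
Proof.
have cgx : {within `[t0, +oo[, continuous (fun s => ip (g i (x s)) (xd s))}.
  move=> t; apply: (cvg_ip ipP); last exact: velocity_continuous.
  by apply: continuous_cvg; [exact: g_cont|exact: position_continuous].
have cfx : {within `[t0, +oo[, continuous (fun s => f i (x s))}.
  move=> t; apply: (@continuous_cvg _ _ _ _ (nbhs_filter t) x (f i)).
    by apply: differentiable_continuous; case: (fg i (x t)).
  exact: position_continuous.
have [M M0 hM] := within_continuous_bounded (ray_continuous_segment (b := T) cgx).
apply: (@wlip_lipschitz _ _ _ _ _ _ M) => // u v t0u uv vT.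
rewrite opprB addrA subrK.
apply: (@derive_bounded_lipschitz _ t0 T M (fun s => f i (x s)) _ _ _ hM) => //.
  exact: ray_continuous_segment cfx.
by move=> t t0t _; exact: (is_derive_gradient (fg i) (is_derive_position t0t)).
Qed.

Let wlip_integral : wlip om t0 T (fun t => \int[mu]_(s in `[t0, t]) (s * `|xd s| ^+ 2)).
Proof.
have [M M0 hM] := within_continuous_bounded (ray_continuous_segment (b := T) speed_continuous).
apply: (@wlip_lipschitz _ _ _ _ _ _ M) => // u v t0u uv vT.
apply: (@derive_bounded_lipschitz _ t0 T M
  (fun t => \int[mu]_(s in `[t0, t]) (s * `|xd s| ^+ 2)) _ _ _ hM) => //.
  apply: parameterized_integral_continuous => //.
  exact: ray_continuous_integrable speed_continuous.
by move=> t t0t _; exact: (is_derive_integral speed_continuous).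
Qed.

(** The freedom in [psi] serves minima: there [psi] freezes the index active at [t]. *)
Let nonincreasing (phi : R -> R) : wlip om t0 T phi ->
  (\forall t \ae mu, t0 < t -> exists (psi : R -> R) (d : R), [/\ is_derive t 1 psi d, d <= 0,
     phi t = psi t & forall s, phi s <= psi s]) ->
  phi T <= phi t0.
Proof.
move=> [L [M [L0 _ _ hL]]] hphi.
apply: (ac_nonincreasing t0T ac_xd L0 hL).
move: hphi; apply: filterS; first exact: (ae_filter_ringOfSetsType mu).
move=> t ht t0t _ e e0.
have [psi [d [h1 h2 h3 h4]]] := ht t0t.
exact: right_growth_le_derive h1 h2 h3 h4 e e0.
Qed.

(** The energy [f i (x s) + 1/2 |xd s|^2] has derivative at most [- (alpha / s) |xd s|^2], and the
    initial velocity is zero. *)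
Lemma objective_le_initial i : f i (x T) <= f i x0.
Proof.
have [_ [_ [_ [_ [_ [xt0 xdt0]]]]]] := sol.
(* Subtracting [0] gives the shape expected by [wlip_f] and [is_derive_fctBcst]. *)
pose phi s := (f i (x s) - 0) + 2^-1 * ip (xd s) (xd s).
suff : phi T <= phi t0.
  rewrite /phi xt0 xdt0 (ip0l ipP) -(normr2_ip ipP).
  have := sqr_ge0 `|xd T|; lra.
apply: nonincreasing.
  apply: wlipD; first exact: wlip_f.
  apply: wlipM; first exact: wlip_cst.
  exact: wlip_ip.
have := ae_acceleration; apply: filterS.
  exact: (ae_filter_ringOfSetsType mu).
move=> t h t0t.
have [acc [dacc vi _]] := h t0t.
exists phi, (ip (g i (x t)) (xd t) + 2^-1 * (ip acc (xd t) + ip (xd t) acc)).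
split=> //.
  apply: is_derive_fctD.
    apply: is_derive_fctBcst.
    exact: (is_derive_gradient (fg i) (is_derive_position t0t)).
  by apply: is_derive_fctZ; exact: is_derive_ip.
rewrite (ipC ipP (xd t) acc).
have : 0 <= alpha / t * ip (xd t) (xd t).
  rewrite -(normr2_ip ipP) mulr_ge0 ?sqr_ge0// divr_ge0//.
    by apply: le_trans alpha_ge3.
  by rewrite ltW// (lt_trans t0_gt0).
have := vi i; lra.
Qed.

Lemma lyapunov_bound z (h : R -> R) :
  (forall i s, h s <= f i (x s) - f i z) ->
  (forall s, exists i, h s = f i (x s) - f i z) ->
  T ^+ 2 * h T <= t0 ^+ 2 * h t0 + (alpha - 1) * `|x0 - z| ^+ 2
    + (3 - alpha) * \int[mu]_(s in `[t0, T]) (s * `|xd s| ^+ 2).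
Proof.
move=> hle hex.
have [_ [_ [_ [_ [_ [xt0 xdt0]]]]]] := sol.
pose I t := \int[mu]_(s in `[t0, t]) (s * `|xd s| ^+ 2).
(* The square [1/2 |2 (x - z) + s xd|^2] is expanded and merged with [(alpha - 3) |x - z|^2]; adding
   [(alpha - 3) * I s] turns the integral estimate into plain monotonicity of [phi]. *)
pose G s := (alpha - 1) * ip (x s - z) (x s - z) + (2 * s) * ip (x s - z) (xd s)
   + 2^-1 * ((s * s) * ip (xd s) (xd s)) + (alpha - 3) * I s.
pose phi s := (s * s) * h s + G s.
have I0 : I t0 = 0 by rewrite /I set_itv1 Rintegral_set1.
have wl : phi T <= phi t0.
  apply: nonincreasing.
    have w2 : wlip om t0 T (fun s => s * s) by exact: wlipM.
    have wZ (k : R) (p : R -> R) : wlip om t0 T p -> wlip om t0 T (fun s => k * p s).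
      by move=> wp; apply: wlipM => //; exact: wlip_cst.
    apply: wlipD.
      apply: wlipM => //.
      exact: (@wlip_min _ _ _ _ _ (fun i s => f i (x s) - f i z)).
    apply: wlipD; last exact: wZ.
    apply: wlipD; last by apply: wZ; apply: wlipM => //; exact: wlip_ip.
    apply: wlipD; first by apply: wZ; exact: wlip_ip.
    by apply: wlipM; [exact: wZ|exact: wlip_ip].
  have := ae_acceleration; apply: filterS.
    exact: (ae_filter_ringOfSetsType mu).
  move=> t hacc t0t.
  have [acc [dacc vi [lam [lam0 lam1 accE]]]] := hacc t0t.
  have t_gt0 : 0 < t by exact: lt_trans t0t.
  have [i hi] := hex t.
  have dx := is_derive_position t0t.
  have dxz : is_derive t 1 (fun s => x s - z) (xd t) by exact: is_derive_fctBcst.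
  have dt : is_derive (t : R) 1 (fun s : R => s) 1 by exact: is_derive_id.
  have dtt := is_derive_fctM dt dt.
  have d0 := is_derive_fctM dtt
    (is_derive_fctBcst (f i z) (is_derive_gradient (fg i) dx)).
  have d1 := is_derive_fctZ (alpha - 1) (is_derive_ip ipP dxz dxz).
  have d2 := is_derive_fctM (is_derive_fctZ 2 dt) (is_derive_ip ipP dxz dacc).
  have d3 := is_derive_fctZ 2^-1 (is_derive_fctM dtt (is_derive_ip ipP dacc dacc)).
  have d4 := is_derive_fctZ (alpha - 3) (is_derive_integral speed_continuous t0t).
  have d5 := is_derive_fctD d0
    (is_derive_fctD (is_derive_fctD (is_derive_fctD d1 d2) d3) d4).
  exists (fun s => (s * s) * (f i (x s) - f i z) + G s).
  eexists; split; first exact: d5.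
  - rewrite (normr2_ip ipP) (ipC ipP (xd t) (x t - z)) (ipC ipP (xd t) acc).
    set w := \sum_(i < m) lam i *: g i (x t) in accE.
    (* Average the gradient inequalities of all [f j] with the weights [lam]. *)
    have wz : h t <= ip (x t - z) w.
      rewrite (ipC ipP) (ip_suml ipP) -[h t]mul1r -lam1 mulr_suml.
      apply: ler_sum => j _; rewrite (ipZl ipP); apply: ler_wpM2l => //.
      have := convex_gradient_le (x t) z (f_convex j) (fg j).
      rewrite -(opprB (x t) z) (ipNr ipP); have := hle j t; lra.
    have e1 : t * ip (x t - z) acc = - alpha * ip (x t - z) (xd t) - t * ip (x t - z) w.
      rewrite accE (ipBr ipP) (ipNr ipP) (ipZr ipP) mulrBr mulrN mulrA.
      by rewrite mulrCA divff ?gt_eqF// mulr1 mulNr.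
    have e2 : t * t * (ip (g i (x t)) (xd t) + ip acc (xd t)) <=
        - (alpha * t * ip (xd t) (xd t)).
      have : t * t * (ip (g i (x t)) (xd t) + ip acc (xd t) +
         alpha / t * ip (xd t) (xd t)) <= 0.
        by rewrite pmulr_rle0 ?mulr_gt0.
      have -> : t * t * (ip (g i (x t)) (xd t) + ip acc (xd t) +
         alpha / t * ip (xd t) (xd t)) =
        t * t * (ip (g i (x t)) (xd t) + ip acc (xd t)) +
          alpha * t * ip (xd t) (xd t) by field; rewrite gt_eqF.
      lra.
    have e3 : t * h t <= t * ip (x t - z) w by rewrite ler_pM2l.
    (* By [e1] the terms in [ip (x t - z) (xd t)] cancel, as [2 (alpha - 1) + 2 - 2 alpha = 0]; [e3]
       disposes of the terms in [h t], and [e2] absorbs [(3 + (alpha - 3)) t |xd t|^2]. *)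
    rewrite -hi; nra.
  - by rewrite /phi hi.
  - by move=> s; rewrite lerD2r; apply: ler_wpM2l => //; rewrite -expr2 sqr_ge0.
(* At the final time the squares are regrouped and dropped; [3 <= alpha] makes both nonnegative. *)
have GT : (alpha - 3) * I T <= G T.
  rewrite /G lerDr.
  have -> : (alpha - 1) * ip (x T - z) (x T - z) + 2 * T * ip (x T - z) (xd T) +
      2^-1 * (T * T * ip (xd T) (xd T)) =
      2^-1 * ip (2 *: (x T - z) + T *: xd T) (2 *: (x T - z) + T *: xd T)
      + (alpha - 3) * ip (x T - z) (x T - z).
    move: (x T - z) => y; rewrite (ipDl ipP) !(ipDr ipP) !(ipZl ipP) !(ipZr ipP) (ipC ipP (xd T)).
    by field.
  rewrite -!(normr2_ip ipP).
  by apply: addr_ge0; apply: mulr_ge0; rewrite ?sqr_ge0 ?subr_ge0.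
have Gt0 : G t0 = (alpha - 1) * `|x0 - z| ^+ 2.
  by rewrite /G I0 xt0 xdt0 !(ipC ipP _ 0) !(ip0l ipP) (normr2_ip ipP) !mulr0 !addr0.
move: wl; rewrite /phi Gt0 -!expr2 -/(I T); lra.
Qed.

End segment.
End inertial_system.

(** * The merit function *)

(** With [0 < m] the default value [+oo] of the minimum is never attained. *)
Lemma bigmin_EFin_attained (R : realType) (m : nat) (F : 'I_m -> R) : (0 < m)%N ->
  exists i, (forall j, F i <= F j) /\
    \big[Order.min/(+oo)%E]_(j < m) (F j)%:E = (F i)%:E.
Proof.
case: m F => // m F _.
have [i _ hi] := @arg_minP _ _ _ (ord0 : 'I_m.+1) xpredT F isT.
exists i; split=> [j|]; first exact: hi.
apply/eqP; rewrite eq_le bigmin_le_cond//=.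
by apply/bigmin_geP; split=> [|j _]; rewrite ?leey// lee_fin hi.
Qed.

Section merit_function.
Context {R : realType} {H : normedModType R} {m : nat}.
Implicit Types (f : 'I_m -> H -> R) (x y z : H).

Lemma u0_ge f x z (c : R) : (forall i, c <= f i x - f i z) -> (c%:E <= u0 f x)%E.
Proof.
move=> hc; apply: le_trans (ereal_sup_ubound _); last by exists z.
by apply/bigmin_geP; split=> [|i _]; rewrite ?leey// lee_fin.
Qed.

Lemma u0_ge0 f x : (0 <= u0 f x)%E.
Proof. by apply: (@u0_ge _ x x) => i; rewrite subrr. Qed.

(** A bound on the whole fibre of [xs] passes to the infimum, so no nearest point of the fibre has
    to exist. *)
Lemma Rconst_ge f x0 xs (c : R) :
  weakly_pareto f xs -> levelset f (fun i => f i x0) xs ->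
  (forall y, (forall i, f i y = f i xs) -> c <= 2^-1 * `|y - x0| ^+ 2) ->
  (c%:E <= Rconst f x0)%E.
Proof.
move=> wp ls hc; apply: le_trans (ereal_sup_ubound _); last by exists xs.
by apply: le_ereal_inf_tmp => _ [y hy <-]; rewrite lee_fin; exact: hc.
Qed.

End merit_function.

(** * Decay rate of the merit function along the trajectory *)

Theorem theorem4p14 (R : realType) (H : completeNormedModType R)
    (ip : H -> H -> R) (m : nat) (f : 'I_m -> H -> R) (g : 'I_m -> H -> H)
    (alpha t0 : R) (x0 : H) (x xd : R -> H) :
  inner_product ip ->
  (0 < m)%N ->
  (forall i, convex_fun (f i)) ->
  (forall i, gradient_of ip (f i) (g i)) ->
  (forall i, continuous (g i)) ->
  3 <= alpha -> 0 < t0 ->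
  solution ip g alpha t0 x0 x xd ->
  (forall y0 y, levelset f (fun i => f i y0) y ->
     exists xs, weakly_pareto f xs /\ levelset f (fun i => f i y) xs) ->
  (Rconst f x0 < +oo)%E ->
  forall t, t0 <= t ->
    ((t ^+ 2)%:E * u0 f (x t) <=
       (t0 ^+ 2)%:E * u0 f x0 + (2 * (alpha - 1))%:E * Rconst f x0
       + ((3 - alpha) * \int[@lebesgue_measure R]_(s in `[t0, t]) (s * `|xd s| ^+ 2))%:E)%E /\
    (u0 f (x t) <=
       ((t0 ^+ 2)%:E * u0 f x0 + (2 * (alpha - 1))%:E * Rconst f x0) * (t ^- 2)%:E)%E.
Proof.
move=> ipP m0 cf fg gc al t00 sol pareto Rfin t t0t.
have tp : 0 < t by exact: lt_le_trans t0t.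
have t2p : 0 < t ^+ 2 by rewrite exprn_gt0.
have t02p : 0 < t0 ^+ 2 by rewrite exprn_gt0.
have al1 : 0 < 2 * (alpha - 1) by lra.
have R0 : (0 <= Rconst f x0)%E.
  have [xs [wp ls]] := pareto x0 x0 (fun i => lexx _).
  by apply: (Rconst_ge wp ls) => y _; rewrite mulr_ge0 ?sqr_ge0.
have Rnum : Rconst f x0 \is a fin_num by rewrite ge0_fin_numE.
set r := fine (Rconst f x0).
have rE : Rconst f x0 = r%:E by rewrite fineK.
rewrite rE -EFinM.
(* The value [-oo] contradicts [u0_ge0], and [+oo] makes both right-hand sides [+oo]. *)
case uE : (u0 f x0) => [U| |]; last first.
- by have := u0_ge0 f x0; rewrite uE.
- rewrite gt0_muley ?lte_fin//= !addye//; split; first by rewrite leey.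
  by rewrite gt0_mulye ?leey// lte_fin invr_gt0.
set I := Rintegral _ _ _.
have I0 : 0 <= I.
  apply: Rintegral_ge0 => s; rewrite /= in_itv/= => /andP[t0s _].
  by rewrite mulr_ge0 ?sqr_ge0// (le_trans (ltW t00)).
pose K := t0 ^+ 2 * U + 2 * (alpha - 1) * r + (3 - alpha) * I.
have xt0 : x t0 = x0 by case: sol => _ [_ [_ [_ [_ []]]]].
have bound z (c : R) : (forall i, c <= f i (x t) - f i z) ->
    t ^+ 2 * c <= t0 ^+ 2 * U + (alpha - 1) * `|x0 - z| ^+ 2 + (3 - alpha) * I.
  move=> hc.
  have [im him] := choice (fun s => bigmin_EFin_attained (fun i => f i (x s) - f i z) m0).
  pose h s := f (im s) (x s) - f (im s) z.
  have := @lyapunov_bound _ _ _ _ _ _ _ _ _ _ _ ipP cf fg gc al t00 sol t t0t z h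
    (fun i s => (him s).1 i) (fun s => ex_intro _ (im s) erefl).
  have ct : t ^+ 2 * c <= t ^+ 2 * h t by rewrite ler_pM2l// hc.
  have hU : t0 ^+ 2 * h t0 <= t0 ^+ 2 * U.
    rewrite ler_pM2l// -lee_fin -uE -xt0; apply: (@u0_ge _ _ _ _ _ z _) => i.
    exact: (him t0).1.
  rewrite -/I; lra.
have bound0 z (c : R) : 0 <= c -> (forall i, c <= f i (x t) - f i z) -> t ^+ 2 * c <= K.
  move=> c0 hc.
  (* Here [0 <= c] is essential: it puts [F z] below [F (x t)], hence below [F x0]. *)
  have lez : levelset f (fun i => f i x0) z.
    move=> i /=; have := objective_le_initial ipP fg gc al t00 sol t0t i.
    by have := hc i; lra.
  have [xs [wp ls]] := pareto x0 z lez.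
  have lexs : levelset f (fun i => f i x0) xs by move=> i; exact: le_trans (ls i) (lez i).
  (* [q] is [bound] solved for [1/2 |y - x0|^2]: it is a lower bound for that quantity on the whole
     fibre of [xs], hence at most [r]. *)
  pose q := (t ^+ 2 * c - t0 ^+ 2 * U - (3 - alpha) * I) / (2 * (alpha - 1)).
  have qE : q * (2 * (alpha - 1)) = t ^+ 2 * c - t0 ^+ 2 * U - (3 - alpha) * I.
    by rewrite divfK// gt_eqF.
  have qr : q <= r.
    rewrite -lee_fin -rE; apply: (Rconst_ge wp lexs) => y yxs.
    have := bound y c; rewrite distrC.
    have hy i : c <= f i (x t) - f i y.
      by rewrite yxs; have := hc i; have := ls i; rewrite /=; lra.
    move=> /(_ hy) bnd; rewrite /q ler_pdivrMr//; lra.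
  have := ler_wpM2r (ltW al1) qr; rewrite /K; lra.
have K0 : 0 <= K.
  have := bound0 (x t) 0 (lexx _); rewrite mulr0; apply => i.
  by rewrite subrr.
have uK : (u0 f (x t) <= (K / t ^+ 2)%:E)%E.
  apply: ge_ereal_sup => _ [z _ <-].
  have [i [hi ->]] := bigmin_EFin_attained (fun i => f i (x t) - f i z) m0.
  rewrite lee_fin ler_pdivlMr// mulrC.
  (* Points [z] with a negative minimum escape [bound0], but for them [0 <= K] suffices. *)
  have [c0|c0] := leP 0 (f i (x t) - f i z); first exact: bound0.
  by apply: le_trans K0; rewrite pmulr_rle0// ltW.
split.
- rewrite -EFinM; apply: (@le_trans _ _ ((t ^+ 2)%:E * (K / t ^+ 2)%:E)%E).
    by apply: lee_wpmul2l => //; rewrite lee_fin ltW.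
  by rewrite -EFinM mulrC divfK// gt_eqF.
- apply: (le_trans uK); rewrite -EFinM lee_fin.
  apply: ler_wpM2r; first by rewrite invr_ge0 ltW.
  by rewrite /K gerDl mulr_le0_ge0// subr_le0.
Qed.
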